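(* Consider the network with 2 CUs, 2 eRRHs and 2 CPs under a non-oblivious stationary randomized (NSR) policy with parameters $b_k^{(n)}$, $r_1\ge r_2$ and threshold $z$, and let $b_k=b_k^{(1)}+b_k^{(2)}$. Then the average AoI $J_c$ of the CUs has the two upper bounds $$J_c\le\frac12\sum_{k=1}^{2}\frac{1}{b_kr_2},$$ $$J_c\le\frac12\sum_{k=1}^{2}\Big(\frac{1-b_k+b_kr_2}{b_kr_2}+(1-r_2)\sum_{n=1}^{2}b_k^{(n)}\sum_{\phi\in\mathcal{G}_n^z}F_{nk}(\phi)\pi_\phi\Big),$$ where, for each $n$, $\pi=(\pi_\phi)_{\phi\in\mathcal{G}_n^z}$ is the steady-state distribution determined by the transition probability matrix $\mathbf{P}$ given in the context, and $F_{nk}$ is given by the linear system $F_{nk}(\phi)=1+\sum_{\phi'\in\mathcal{G}_n^z,\ \phi'_k\ne1}\mathbf{P}_{\phi\phi'}F_{nk}(\phi')$, $\phi\in\mathcal{G}_n^z$.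
   Context: Time is slotted, $t=0,1,2,\dots$; $m,n,k\in\{1,2\}$ index content users (CUs), eRRHs and content providers (CPs). Policy parameters: $b_k^{(n)}\in[0,1]$ with $b_k=b_k^{(1)}+b_k^{(2)}\le1$; $r_1\ge r_2$ in $[0,1]$; $b=b_1+b_2\le B$ and $r=r_1+r_2\le R$ for given resource bounds $B,R$; a predefined integer threshold $z$. Put $\zeta_{nk}=1-(1-b_k^{(n)})^2$. In slot $t$, $\beta_{mk}^{(n)}(t)\in\{0,1\}$ indicates that CU $m$ sends a request for CP $k$ to eRRH $n$; $\sum_n\beta_{mk}^{(n)}(t)\le1$, $\Pr(\beta_{mk}^{(n)}(t)=1)=b_k^{(n)}$, and decisions of different CUs $m$ are independent. Upon receiving at least one request for CP $k$, eRRH $n$ either commands CP $k$ to send a new packet ($\gamma_{nk}(t)=1$) or uses its cached packet ($\gamma_{nk}(t)=0$); the $\gamma_{nk}(t)$ are independent over $n$ and over $k$, and $\Pr(\gamma_{nk}(t)=1)=r_{nk}(t)$, where $r_{nk}(t)=r_k$ if $g_{n1}(t)\ge g_{n2}(t)$ and $g_{n2}(t)<z$; $r_{nk}(t)=r-r_k$ if $g_{n1}(t)<g_{n2}(t)$ and $g_{n1}(t)<z$; $r_{nk}(t)=r/2$ if $g_{n1}(t)\ge z$ and $g_{n2}(t)\ge z$. AoI at the eRRHs: $g_{nk}(0)=1$; $g_{nk}(t+1)=1$ if $\gamma_{nk}(t)\sum_m\beta_{mk}^{(n)}(t)>0$, which happens with probability $r_{nk}(t)\zeta_{nk}$, and $g_{nk}(t+1)=g_{nk}(t)+1$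 otherwise. AoI at the CUs: $h_{mk}(0)=1$; $h_{mk}(t+1)=1$ if $\beta_{mk}^{(n)}(t)\gamma_{nk}(t)=1$ for some $n$; $h_{mk}(t+1)=\min\{h_{mk}(t),g_{nk}(t)\}+1$ if $\beta_{mk}^{(n)}(t)(1-\gamma_{nk}(t))=1$ for some $n$; $h_{mk}(t+1)=h_{mk}(t)+1$ if $\sum_n\beta_{mk}^{(n)}(t)=0$. The average AoI of the CUs is $J_c=\lim_{T\to\infty}\frac1T\sum_{t=1}^T\frac14\sum_{m=1}^{2}\sum_{k=1}^{2}\mathbb{E}[h_{mk}(t)]$. Truncated chain: $G_n^z(t)=(g_{n1}^z(t),g_{n2}^z(t))$, where $g_{nk}^z(t+1)=1$ with probability $r_{nk}(t)\zeta_{nk}$ and $g_{nk}^z(t+1)=\min\{g_{nk}^z(t)+1,z\}$ with probability $1-r_{nk}(t)\zeta_{nk}$. It is a Markov process with a unique steady-state distribution, and its state space $\mathcal{G}_n^z$ consists of the $z^2$ pairs $\phi=(\phi_1,\phi_2)\in\{1,\dots,z\}^2$. $F_{nk}(\phi)$ is the expected time until eRRH $n$ next receives a new packet from CP $k$, given $G_n^z(t)=\phi$. Transition matrix $\mathbf{P}$: write $r_0=r/2$, $\bar r_j=1-r_j$ ($j=0,1,2$), $\bar\zeta_{nk}=(1-b_k^{(n)})^2$, and partition the states $\phi$ into $\mathcal{G}_1^z=\{\phi_2<\phi_1\}$, $\mathcal{G}_2^z=\{\phi_1<\phi_2\}$, $\mathcal{G}_3^z=\{\phi_1=\phi_2\}$.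 The possible transitions $\phi\to\phi'$ are: (A) $\phi'=(1,1)$: $\mathbf{P}_{\phi\phi'}=r_0^2\zeta_{n1}\zeta_{n2}$ for $\phi\in\mathcal{G}_3^z$, and $r_1r_2\zeta_{n1}\zeta_{n2}$ for $\phi\in\mathcal{G}_1^z\cup\mathcal{G}_2^z$. (B) $\phi'=(1,\min\{\phi_2+1,z\})$: $r_0\zeta_{n1}(\bar r_0\zeta_{n2}+\bar\zeta_{n2})$ for $\phi\in\mathcal{G}_3^z$; $r_1\zeta_{n1}(\bar r_2\zeta_{n2}+\bar\zeta_{n2})$ for $\phi\in\mathcal{G}_1^z$; $r_2\zeta_{n1}(\bar r_1\zeta_{n2}+\bar\zeta_{n2})$ for $\phi\in\mathcal{G}_2^z$. (C) $\phi'=(\min\{\phi_1+1,z\},1)$: $r_0\zeta_{n2}(\bar r_0\zeta_{n1}+\bar\zeta_{n1})$ for $\phi\in\mathcal{G}_3^z$; $r_2\zeta_{n2}(\bar r_1\zeta_{n1}+\bar\zeta_{n1})$ for $\phi\in\mathcal{G}_1^z$; $r_1\zeta_{n2}(\bar r_2\zeta_{n1}+\bar\zeta_{n1})$ for $\phi\in\mathcal{G}_2^z$. (D) $\phi'=(\min\{\phi_1+1,z\},\min\{\phi_2+1,z\})$: $(\bar r_0\zeta_{n1}+\bar\zeta_{n1})(\bar r_0\zeta_{n2}+\bar\zeta_{n2})$ for $\phi\in\mathcal{G}_3^z$; $(\bar r_1\zeta_{n1}+\bar\zeta_{n1})(\bar r_2\zeta_{n2}+\bar\zeta_{n2})$ for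 $\phi\in\mathcal{G}_1^z$; $(\bar r_2\zeta_{n1}+\bar\zeta_{n1})(\bar r_1\zeta_{n2}+\bar\zeta_{n2})$ for $\phi\in\mathcal{G}_2^z$.
   Formalization: The rule for r_nk(t) and the rows of P on ties g_n1=g_n2<z conflict when r_1>r_2; the theorem uses one tie rule in both policy and P (either r_k or r/2), and assumes z≥2 (for z=1 P is ill-defined and the second bound fails), b_k>0 and r_2>0. *)

(* Defs.v *)
From HB Require Import structures.
From mathcomp Require Import all_boot all_order all_algebra.
From mathcomp Require Import all_classical all_reals all_analysis.
Set Implicit Arguments.
Unset Strict Implicit.
Unset Printing Implicit Defensive.
Import Order.TTheory GRing.Theory Num.Theory numFieldNormedType.Exports.
Local Open Scope ring_scope.

(* CUs m, eRRHs n and CPs k all range over 'I_2. *)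
Definition i1 : 'I_2 := ord0.
Definition i2 : 'I_2 := ord_max.

(* b n k is b_k^(n) and r k is r_k. *)
Definition btot (R : realType) (b : 'I_2 -> 'I_2 -> R) (k : 'I_2) : R :=
  \sum_(n < 2) b n k.
Definition rtot (R : realType) (r : 'I_2 -> R) : R := \sum_(k < 2) r k.

Record nsr_parameters (R : realType) (b : 'I_2 -> 'I_2 -> R) (r : 'I_2 -> R)
    (Bmax Rmax : R) : Prop := NsrParameters {
  nsr_b : forall n k, 0 <= b n k <= 1;
  nsr_btot : forall k, btot b k <= 1;
  nsr_r : forall k, 0 <= r k <= 1;
  nsr_r_le : r i2 <= r i1;
  nsr_B : \sum_(k < 2) btot b k <= Bmax;
  nsr_R : rtot r <= Rmax }.

(* What the eRRH does when both of its cached packets have the same age < z: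
   - ties_first: CP k is commanded with probability r_k;
   - ties_even: both CPs are commanded with probability r/2.
   The three-case formula for r_nk(t) (with g_n1 >= g_n2 in its first case)
   prescribes ties_first, whereas the rows G_3^z of the transition matrix are
   those of ties_even; the two agree away from ties.  The rule is a parameter,
   shared by the policy and by the matrix. *)
Inductive tie_rule := ties_first | ties_even.

(* r_nk as a function of a1 = g_n1 and a2 = g_n2. *)
Definition rate (R : realType) (tie : tie_rule) (r : 'I_2 -> R) (z : nat)
    (k : 'I_2) (a1 a2 : nat) : R :=
  let by_age :=
    if (a2 <= a1)%N && (a2 < z)%N then r k
    else if (a1 < a2)%N && (a1 < z)%N then rtot r - r k
    else rtot r / 2 in
  match tie with
  | ties_first => by_age
  | ties_even => if a1 == a2 then rtot r / 2 else by_age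
  end.

(* A realisation of the randomness: bt m k n t is beta_mk^(n)(t) and
   gm n k t is gamma_nk(t).  The ages are deterministic functions of it. *)
Definition requests := 'I_2 -> 'I_2 -> 'I_2 -> nat -> bool.
Definition commands := 'I_2 -> 'I_2 -> nat -> bool.

Fixpoint g_aoi (bt : requests) (gm : commands) (n k : 'I_2) (t : nat) : nat :=
  if t is s.+1 then
    if (0 < gm n k s * \sum_(m < 2) bt m k n s)%N then 1%N
    else (g_aoi bt gm n k s).+1
  else 1%N.

Fixpoint h_aoi (bt : requests) (gm : commands) (m k : 'I_2) (t : nat) : nat :=
  if t is s.+1 then
    if [exists n : 'I_2, bt m k n s && gm n k s] then 1%N
    else if [pick n : 'I_2 | bt m k n s && ~~ gm n k s] is Some n then
      (minn (h_aoi bt gm m k s) (g_aoi bt gm n k s)).+1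
    else (h_aoi bt gm m k s).+1
  else 1%N.

(* Probability that the pair (beta_mk^(1)(t), beta_mk^(2)(t)) equals c. *)
Definition request_prob (R : realType) (b : 'I_2 -> 'I_2 -> R) (k : 'I_2)
    (c : 'I_2 -> bool) : R :=
  if c i1 && c i2 then 0
  else if c i1 then b i1 k
  else if c i2 then b i2 k
  else 1 - btot b k.

(* Conditional probability of the outcome (bt, gm) of slot t given the outcome
   of the slots s < t. *)
Definition slot_prob (R : realType) (tie : tie_rule) (b : 'I_2 -> 'I_2 -> R)
    (r : 'I_2 -> R) (z : nat) (bt : requests) (gm : commands) (t : nat) : R :=
  (\prod_(m < 2) \prod_(k < 2) request_prob b k (fun n => bt m k n t)) *
  \prod_(n < 2) \prod_(k < 2)
    (let p := rate tie r z k (g_aoi bt gm n i1 t) (g_aoi bt gm n i2 t) in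
     if gm n k t then p else 1 - p).

Section process.
Context d (T : measurableType d) (R : realType) (P : probability T R).
Variables (beta : 'I_2 -> 'I_2 -> 'I_2 -> nat -> {RV P >-> bool})
          (gamma : 'I_2 -> 'I_2 -> nat -> {RV P >-> bool}).

Definition path_requests (w : T) : requests := fun m k n t => beta m k n t w.
Definition path_commands (w : T) : commands := fun n k t => gamma n k t w.

Definition history (bt : requests) (gm : commands) (t : nat) : set T :=
  [set w | forall s, (s < t)%N ->
     (forall m k n, beta m k n s w = bt m k n s) /\
     (forall n k, gamma n k s w = gm n k s)].

(* The second field is the chain rule for the law of the whole process: given
   the past, the request decisions of slot t are independent over the CUs and
   the CPs, with Pr(beta_mk^(n)(t) = 1) = b_k^(n), and the gamma_nk(t) are
   independent of them and of each other, with Pr(gamma_nk(t) = 1) = r_nk(t).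
   gamma_nk(t) is drawn in every slot; it has no effect on the ages when no
   request for CP k reaches eRRH n. *)
Record nsr_process (tie : tie_rule) (b : 'I_2 -> 'I_2 -> R) (r : 'I_2 -> R)
    (z : nat) : Prop := NsrProcess {
  nsr_one_request : forall m k t w, (\sum_(n < 2) beta m k n t w <= 1)%N;
  nsr_law : forall bt gm t,
    P (history bt gm t.+1) =
    (P (history bt gm t) * (slot_prob tie b r z bt gm t)%:E)%E }.

Definition mean_h (m k : 'I_2) (t : nat) : \bar R :=
  'E_P[fun w => (h_aoi (path_requests w) (path_commands w) m k t)%:R].

(* J_c is the limit of this sequence. *)
Definition avg_aoi (N : nat) : \bar R :=
  ((N%:R^-1)%:E * \sum_(1 <= t < N.+1)
     ((4^-1)%:E * \sum_(m < 2) \sum_(k < 2) mean_h m k t))%E.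

End process.

(* (i, j) stands for the pair of ages (i + 1, j + 1). *)
Definition state (z : nat) : finType := ('I_z * 'I_z)%type.
Definition age (z : nat) (phi : state z) (k : 'I_2) : nat :=
  if k == i1 then phi.1.+1 else phi.2.+1.

(* zetabar b n k is (1 - b_k^(n))^2 and zeta b n k is zeta_nk. *)
Definition zetabar (R : realType) (b : 'I_2 -> 'I_2 -> R) (n k : 'I_2) : R :=
  (1 - b n k) ^+ 2.
Definition zeta (R : realType) (b : 'I_2 -> 'I_2 -> R) (n k : 'I_2) : R :=
  1 - zetabar b n k.

(* The four kinds (A)-(D) of transitions phi -> phi'.  With rule ties_even the
   pair (rate 1, rate 2) is (r_0, r_0) on G_3^z, (r_1, r_2) on G_1^z and
   (r_2, r_1) on G_2^z.  The four targets are distinct only when 2 <= z. *)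
Definition trans (R : realType) (tie : tie_rule) (b : 'I_2 -> 'I_2 -> R)
    (r : 'I_2 -> R) (z : nat) (n : 'I_2) (phi phi' : state z) : R :=
  let rho k := rate tie r z k (age phi i1) (age phi i2) in
  let hit k := rho k * zeta b n k in
  let miss k := (1 - rho k) * zeta b n k + zetabar b n k in
  let reset k := age phi' k == 1%N in
  let grow k := age phi' k == minn (age phi k).+1 z in
  if reset i1 && reset i2 then hit i1 * hit i2
  else if reset i1 && grow i2 then hit i1 * miss i2
  else if grow i1 && reset i2 then miss i1 * hit i2
  else if grow i1 && grow i2 then miss i1 * miss i2
  else 0.

Record steady_state (R : realType) (z : nat) (Q : state z -> state z -> R)
    (pi : state z -> R) : Prop := SteadyState {
  steady_ge0 : forall phi, 0 <= pi phi;
  steady_sum1 : \sum_phi pi phi = 1;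
  steady_eq : forall phi', pi phi' = \sum_phi pi phi * Q phi phi' }.

Definition reception_system (R : realType) (z : nat)
    (Q : state z -> state z -> R) (k : 'I_2) (F : state z -> R) : Prop :=
  forall phi, F phi = 1 + \sum_(phi' | age phi' k != 1%N) Q phi phi' * F phi'.

(* Main.v *)
(* The age h of CP k at a CU satisfies, slot by slot and given the past,
     E[h'] <= 1 + (1 - b_k) h + (1 - r_2) sum_n b_k^(n) min(h, g_nk),
   because every command probability is at least r_2.  Bounding the minimum by
   h makes 1 / (b_k r_2) an invariant bound on E[h]; bounding it by g_nk and
   inserting the first bound leaves the time averages of E[g_nk].

   These averages are controlled by the test function g_nk F_nk: the system for
   F_nk gives E[(g F)(t+1) - (g F)(t)] = E[F(phi(t+1))] - E[g(t)], which
   telescopes, and g F >= 0.  It remains to see that E[F(phi(t))] converges to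
   the mean of F under pi.  After z steps the truncated chain is at one fixed
   state with probability bounded below, uniformly in its start: a coordinate
   with b_k^(n) > 0 may be reset in the last step, and one with b_k^(n) = 0 has
   grown to z.  Hence z steps contract oscillations (Doeblin). *)

Require Import Defs.
From HB Require Import structures.
From mathcomp Require Import all_boot all_order all_algebra.
From mathcomp Require Import all_classical all_reals all_analysis.
From mathcomp Require Import measurable_realfun ring lra zify.
Import Order.TTheory GRing.Theory Num.Theory numFieldNormedType.Exports.
Local Open Scope classical_set_scope.
Local Open Scope ring_scope.

(** * Ages along a finite history *)

Lemma big_I2 (A : Type) (idx : A) (op : Monoid.law idx) (F : 'I_2 -> A) :
  \big[op/idx]_(i < 2) F i = op (F i1) (F i2).
Proof. by rewrite big_ord_recl big_ord1; congr (op _ (F _)); apply: val_inj. Qed.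

Lemma I2P (i : 'I_2) : {i = i1} + {i = i2}.
Proof.
by case: i => [[|[|//]] p]; [left|right]; apply: val_inj.
Qed.

Lemma sum_prod (V : nmodType) (A B : finType) (f : A * B -> V) :
  \sum_p f p = \sum_a \sum_c f (a, c).
Proof.
rewrite (pair_bigA _ (fun a c => f (a, c)))/=.
by apply: eq_bigr => -[].
Qed.

(** Pairs replace functions on ['I_2], so that slot outcomes form a product of booleans over which
    sums expand explicitly. *)
Definition sel {A : Type} (p : A * A) (i : 'I_2) : A :=
  if i == i1 then p.1 else p.2.

(* What happens to one CP in a slot: the requests of CU 1, the requests of CU 2
   and the commands, each of them a pair indexed by the eRRHs. *)
Definition cp_slot : finType :=
  ((bool * bool) * (bool * bool) * (bool * bool))%type.
Definition slot : finType := (cp_slot * cp_slot)%type.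

(** Default value for [nth]; the ages at time [size x] read only positions below [size x]. *)
Definition slot0 : slot :=
  let c := ((false, false), (false, false), (false, false)) in (c, c).

Definition req_of (x : seq slot) : requests :=
  fun m k n s => sel (sel (sel (nth slot0 x s) k).1 m) n.
Definition cmd_of (x : seq slot) : commands :=
  fun n k s => sel (sel (nth slot0 x s) k).2 n.

Definition g_of (x : seq slot) (n k : 'I_2) : nat :=
  g_aoi (req_of x) (cmd_of x) n k (size x).
Definition h_of (x : seq slot) (m k : 'I_2) : nat :=
  h_aoi (req_of x) (cmd_of x) m k (size x).

Lemma g_aoi_ext bt gm bt' gm' n k t :
  (forall s, (s < t)%N -> (forall m k n, bt m k n s = bt' m k n s) /\
     (forall n k, gm n k s = gm' n k s)) ->
  g_aoi bt gm n k t = g_aoi bt' gm' n k t.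
Proof.
elim: t => [//|t IH] E /=; have [Eb Eg] := E t (ltnSn t).
rewrite !big_I2 !Eb !Eg IH// => s st; apply: E; exact: ltnW.
Qed.

Lemma h_aoi_ext bt gm bt' gm' m k t :
  (forall s, (s < t)%N -> (forall m k n, bt m k n s = bt' m k n s) /\
     (forall n k, gm n k s = gm' n k s)) ->
  h_aoi bt gm m k t = h_aoi bt' gm' m k t.
Proof.
elim: t => [//|t IH] E /=; have [Eb Eg] := E t (ltnSn t).
have E' s : (s < t)%N -> (forall m k n, bt m k n s = bt' m k n s) /\
     (forall n k, gm n k s = gm' n k s) by move=> st; apply: E; exact: ltnW.
rewrite IH//.
rewrite (eq_existsb (P2 := fun n => bt' m k n t && gm' n k t)); last first.
  by move=> n; rewrite Eb Eg.
rewrite (eq_pick (Q := fun n => bt' m k n t && ~~ gm' n k t)); last first.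
  by move=> n; rewrite Eb Eg.
by case: ifP => // _; case: pickP => // n _; rewrite (g_aoi_ext _ _ bt' gm').
Qed.

Lemma g_aoi_gt0 bt gm n k t : (0 < g_aoi bt gm n k t)%N.
Proof. by case: t => //= t; case: ifP. Qed.

(** With at most one of the two requests present, [pick] has no choice to make. *)
Lemma h_aoiS bt gm m k t :
  ~~ (bt m k i1 t && bt m k i2 t) ->
  h_aoi bt gm m k t.+1 =
  if bt m k i1 t then
    if gm i1 k t then 1%N
    else (minn (h_aoi bt gm m k t) (g_aoi bt gm i1 k t)).+1
  else if bt m k i2 t then
    if gm i2 k t then 1%N
    else (minn (h_aoi bt gm m k t) (g_aoi bt gm i2 k t)).+1
  else (h_aoi bt gm m k t).+1.
Proof.
move=> /= one; have -> : [exists n, bt m k n t && gm n k t] =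
    (bt m k i1 t && gm i1 k t) || (bt m k i2 t && gm i2 k t).
  apply/existsP/orP => [[n]|].
    by case: (I2P n) => -> H; [left|right].
  by case=> H; [exists i1|exists i2].
case: pickP => [n|no]; last first.
  by move: one (no i1) (no i2); do 4 case: (_ t).
by case: (I2P n) => ->; move: one; do 4 case: (_ t).
Qed.

(** * One-slot sums for a single CP *)

Section slot_law.
Context (R : realType) (b : 'I_2 -> 'I_2 -> R) (k : 'I_2).

Definition cp_weight (p1 p2 : R) (c : cp_slot) : R :=
  request_prob b k (sel c.1.1) * request_prob b k (sel c.1.2) *
  ((if c.2.1 then p1 else 1 - p1) * (if c.2.2 then p2 else 1 - p2)).

Lemma sum_cp_slot (f : cp_slot -> R) :
  \sum_c f c = \sum_(a : bool * bool) \sum_(a' : bool * bool)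
    \sum_(c : bool * bool) f (a, a', c).
Proof. by rewrite sum_prod sum_prod. Qed.

Lemma sum_bool2 (f : bool * bool -> R) : \sum_a f a =
  f (true, true) + f (true, false) + (f (false, true) + f (false, false)).
Proof. by rewrite sum_prod !big_bool. Qed.

Lemma sum_cp_request (m : 'I_2) (p1 p2 v u1 u2 u0 : R) :
  \sum_c cp_weight p1 p2 c *
    (if sel (sel c.1 m) i1 then if c.2.1 then v else u1
     else if sel (sel c.1 m) i2 then if c.2.2 then v else u2 else u0) =
  b i1 k * (p1 * v + (1 - p1) * u1) + b i2 k * (p2 * v + (1 - p2) * u2) +
  (1 - btot b k) * u0.
Proof.
rewrite sum_cp_slot !sum_bool2 /cp_weight /request_prob /sel/= /btot big_I2/=.
by case: (I2P m) => -> /=; ring.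
Qed.

(** A renewal needs a command and, independently, a request from at least one of two independent
    CUs; the latter has probability [zeta]. *)
Lemma sum_cp_reset (n : 'I_2) (p : 'I_2 -> R) (u v : R) :
  \sum_c cp_weight (p i1) (p i2) c *
    (if sel c.2 n && (sel c.1.1 n || sel c.1.2 n) then u else v) =
  p n * zeta b n k * u + (1 - p n * zeta b n k) * v.
Proof.
rewrite sum_cp_slot !sum_bool2 /cp_weight /request_prob /sel/= /btot big_I2/=.
by rewrite /zeta /zetabar; case: (I2P n) => -> /=; ring.
Qed.

Lemma sum_cp_weight (p1 p2 : R) : \sum_c cp_weight p1 p2 c = 1.
Proof.
rewrite sum_cp_slot !sum_bool2 /cp_weight /request_prob /sel/= /btot big_I2/=.
ring.
Qed.

End slot_law.

Lemma nth_rcons_last (x : seq slot) (o : slot) :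
  nth slot0 (rcons x o) (size x) = o.
Proof. by rewrite nth_rcons ltnn eqxx. Qed.

Lemma req_of_rcons x o m k n s :
  (s < size x)%N -> req_of (rcons x o) m k n s = req_of x m k n s.
Proof. by move=> sx; rewrite /req_of nth_rcons sx. Qed.

Lemma cmd_of_rcons x o n k s :
  (s < size x)%N -> cmd_of (rcons x o) n k s = cmd_of x n k s.
Proof. by move=> sx; rewrite /cmd_of nth_rcons sx. Qed.

Lemma g_aoi_rcons x o n k :
  g_aoi (req_of (rcons x o)) (cmd_of (rcons x o)) n k (size x) = g_of x n k.
Proof.
by apply: g_aoi_ext => s sx; split=> *; [rewrite req_of_rcons|rewrite cmd_of_rcons].
Qed.

Lemma h_aoi_rcons x o m k :
  h_aoi (req_of (rcons x o)) (cmd_of (rcons x o)) m k (size x) = h_of x m k.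
Proof.
by apply: h_aoi_ext => s sx; split=> *; [rewrite req_of_rcons|rewrite cmd_of_rcons].
Qed.

Definition renewed (n : 'I_2) (c : cp_slot) : bool :=
  sel c.2 n && (sel c.1.1 n || sel c.1.2 n).

Lemma g_of_rcons x o n k :
  g_of (rcons x o) n k = if renewed n (sel o k) then 1%N else (g_of x n k).+1.
Proof.
rewrite {1}/g_of size_rcons /= g_aoi_rcons big_I2 /req_of /cmd_of nth_rcons_last.
have -> : sel (sel o k).1 i1 = (sel o k).1.1 by [].
have -> : sel (sel o k).1 i2 = (sel o k).1.2 by [].
by rewrite /renewed; do 3 case: (sel _ n).
Qed.

Definition h_next (hh g1 g2 : nat) (m : 'I_2) (c : cp_slot) : nat :=
  if sel (sel c.1 m) i1 then if c.2.1 then 1%N else (minn hh g1).+1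
  else if sel (sel c.1 m) i2 then if c.2.2 then 1%N else (minn hh g2).+1
  else hh.+1.

Lemma h_of_rcons x o m k :
  ~~ (sel (sel (sel o k).1 m) i1 && sel (sel (sel o k).1 m) i2) ->
  h_of (rcons x o) m k =
  h_next (h_of x m k) (g_of x i1 k) (g_of x i2 k) m (sel o k).
Proof.
move=> one; rewrite {1}/h_of size_rcons h_aoiS; last first.
  by rewrite /req_of nth_rcons_last.
by rewrite h_aoi_rcons !g_aoi_rcons /req_of /cmd_of nth_rcons_last.
Qed.

(** * One-slot transitions of the ages *)

Section one_slot.
Context (R : realType) (tie : tie_rule) (b : 'I_2 -> 'I_2 -> R)
  (r : 'I_2 -> R) (z : nat).

Definition rate_of (x : seq slot) (n k : 'I_2) : R :=
  rate tie r z k (g_of x n i1) (g_of x n i2).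

Definition step_weight (x : seq slot) (o : slot) : R :=
  slot_prob tie b r z (req_of (rcons x o)) (cmd_of (rcons x o)) (size x).

(** Given the past, the two CPs are independent, so the factors of [slot_prob] regroup CP by CP. *)
Lemma step_weightE x o : step_weight x o =
  cp_weight R b i1 (rate_of x i1 i1) (rate_of x i2 i1) o.1 *
  cp_weight R b i2 (rate_of x i1 i2) (rate_of x i2 i2) o.2.
Proof.
rewrite /step_weight /slot_prob !big_I2 !g_aoi_rcons /cp_weight /rate_of.
rewrite /request_prob /req_of /cmd_of nth_rcons_last /=.
set Q11 := (X in X * _ * _ * _); set Q12 := (X in _ * X * _ * _).
set Q21 := (X in _ * (X * _) * _); set Q22 := (X in _ * (_ * X) * _).
set C11 := (X in _ * (X * _ * _)); set C12 := (X in _ * (_ * X * _)).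
set C21 := (X in _ * (_ * (X * _))); set C22 := (X in _ * (_ * (_ * X))).
rewrite -[RHS]/(Q11 * Q21 * (C11 * C21) * (Q12 * Q22 * (C12 * C22))).
ring.
Qed.

Lemma sum_step_cp x k (f : cp_slot -> R) :
  \sum_o step_weight x o * f (sel o k) =
  \sum_c cp_weight R b k (rate_of x i1 k) (rate_of x i2 k) c * f c.
Proof.
under eq_bigr do rewrite step_weightE.
rewrite sum_prod; case: (I2P k) => ->.
  apply: eq_bigr => c _; under eq_bigr do rewrite /sel /= mulrAC.
  by rewrite -mulr_sumr sum_cp_weight mulr1.
rewrite exchange_big; apply: eq_bigr => c _.
under eq_bigr do rewrite /sel /= -mulrA.
by rewrite -mulr_suml sum_cp_weight mul1r.
Qed.

Lemma sum_step_weight x : \sum_o step_weight x o = 1.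
Proof.
have := sum_step_cp x i1 (fun=> 1).
by under eq_bigr do rewrite mulr1; under [RHS]eq_bigr do rewrite mulr1;
  rewrite sum_cp_weight.
Qed.

Lemma sum_step_h x m k :
  let p n := rate_of x n k in
  let u n := (minn (h_of x m k) (g_of x n k)).+1%:R in
  \sum_o step_weight x o * (h_of (rcons x o) m k)%:R =
  b i1 k * (p i1 + (1 - p i1) * u i1) + b i2 k * (p i2 + (1 - p i2) * u i2) +
  (1 - btot b k) * (h_of x m k).+1%:R.
Proof.
move=> p u.
have := sum_cp_request R b k m (p i1) (p i2) 1 (u i1) (u i2) (h_of x m k).+1%:R.
rewrite !mulr1 => <-.
rewrite (eq_bigr (fun o => step_weight x o *
    (h_next (h_of x m k) (g_of x i1 k) (g_of x i2 k) m (sel o k))%:R)).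
  rewrite (sum_step_cp x k (fun c =>
    (h_next (h_of x m k) (g_of x i1 k) (g_of x i2 k) m c)%:R)).
  apply: eq_bigr => c _; congr (_ * _); rewrite /h_next.
  by do 2 (case: ifP => // _; first by case: ifP).
(* [h_of_rcons] excludes simultaneous requests of CU m to both eRRHs; such outcomes have weight 0 by
   [request_prob]. *)
move=> o _; case: (boolP (sel (sel (sel o k).1 m) i1 && sel (sel (sel o k).1 m) i2)).
  move=> two; suff -> : step_weight x o = 0 by rewrite !mul0r.
  rewrite step_weightE /cp_weight /request_prob.
  by case: (I2P k) two => ->; case: (I2P m) => -> ->; rewrite !(mul0r, mulr0).
by move=> one; rewrite h_of_rcons.
Qed.

Lemma sum_step_g x n (Phi : nat -> nat -> R) :
  let g k := g_of x n k in
  let hit k := rate_of x n k * zeta b n k in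
  \sum_o step_weight x o *
     Phi (g_of (rcons x o) n i1) (g_of (rcons x o) n i2) =
  hit i1 * (hit i2 * Phi 1%N 1%N + (1 - hit i2) * Phi 1%N (g i2).+1) +
  (1 - hit i1) *
    (hit i2 * Phi (g i1).+1 1%N + (1 - hit i2) * Phi (g i1).+1 (g i2).+1).
Proof.
move=> g hit; pose nxt k c := if renewed n c then 1%N else (g k).+1.
under eq_bigr do rewrite step_weightE !g_of_rcons.
rewrite sum_prod /=.
have E2 a : \sum_c cp_weight R b i2 (rate_of x i1 i2) (rate_of x i2 i2) c *
   Phi a (nxt i2 c) = hit i2 * Phi a 1%N + (1 - hit i2) * Phi a (g i2).+1.
  rewrite -(sum_cp_reset R b i2 n (fun n => rate_of x n i2)).
  by apply: eq_bigr => c _; congr (_ * _); rewrite /nxt /renewed; case: ifP.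
rewrite -(sum_cp_reset R b i1 n (fun n => rate_of x n i1)).
apply: eq_bigr => c _.
rewrite (eq_bigr (fun j => cp_weight R b i1 (rate_of x i1 i1) (rate_of x i2 i1) c *
  (cp_weight R b i2 (rate_of x i1 i2) (rate_of x i2 i2) j *
   Phi (nxt i1 c) (nxt i2 j)))); last by move=> j _; rewrite mulrA.
rewrite -mulr_sumr E2; congr (_ * _).
by rewrite /nxt /renewed; case: ifP.
Qed.

End one_slot.

(** * The law of the process on finite histories *)

Section process_law.
Context (R : realType) (d : measure_display) (T : measurableType d)
  (P : probability T R)
  (beta : 'I_2 -> 'I_2 -> 'I_2 -> nat -> {RV P >-> bool})
  (gamma : 'I_2 -> 'I_2 -> nat -> {RV P >-> bool}).

Definition slot_of (w : T) (s : nat) : slot :=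
  let c k := ((beta i1 k i1 s w, beta i1 k i2 s w),
              (beta i2 k i1 s w, beta i2 k i2 s w),
              (gamma i1 k s w, gamma i2 k s w)) in (c i1, c i2).

Definition past (w : T) (t : nat) : seq slot := mkseq (slot_of w) t.

Lemma req_of_past w t m k n s :
  (s < t)%N -> req_of (past w t) m k n s = beta m k n s w.
Proof.
move=> st; rewrite /req_of nth_mkseq//.
by case: (I2P m) => ->; case: (I2P k) => ->; case: (I2P n) => ->.
Qed.

Lemma cmd_of_past w t n k s :
  (s < t)%N -> cmd_of (past w t) n k s = gamma n k s w.
Proof.
move=> st; rewrite /cmd_of nth_mkseq//.
by case: (I2P k) => ->; case: (I2P n) => ->.
Qed.

Definition cylinder (x : seq slot) : set T :=
  history beta gamma (req_of x) (cmd_of x) (size x).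

(** Each [w] thus lies in exactly one cylinder of each length, the one given by its own past. *)
Lemma cylinderP x w : cylinder x w <-> x = past w (size x).
Proof.
split=> [E|E s sx]; last first.
  split=> *; first by rewrite -(req_of_past w (size x))// -E.
  by rewrite -(cmd_of_past w (size x))// -E.
apply: (@eq_from_nth _ slot0); first by rewrite size_mkseq.
move=> s sx; have [Eb Eg] := E s sx; rewrite nth_mkseq// /slot_of !Eb !Eg.
rewrite /req_of /cmd_of /sel/=.
by case: (nth _ _ _) => -[[[? ?] [? ?]] [? ?]] [[[? ?] [? ?]] [? ?]].
Qed.

Lemma history_rcons x o :
  history beta gamma (req_of (rcons x o)) (cmd_of (rcons x o)) (size x) =
  cylinder x.
Proof.
apply/seteqP; split=> w E s sx; have [Eb Eg] := E s sx.
  by split=> *; rewrite ?Eb ?Eg (req_of_rcons, cmd_of_rcons).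
by split=> *; rewrite ?Eb ?Eg (req_of_rcons, cmd_of_rcons).
Qed.

Lemma measurable_history bt gm t : measurable (history beta gamma bt gm t).
Proof.
have -> : history beta gamma bt gm t = \bigcap_(s in `I_t)
   ((\bigcap_(i in [set: 'I_2 * 'I_2 * 'I_2])
       (beta i.1.1 i.1.2 i.2 s @^-1` [set bt i.1.1 i.1.2 i.2 s])) `&`
    (\bigcap_(i in [set: 'I_2 * 'I_2])
       (gamma i.1 i.2 s @^-1` [set gm i.1 i.2 s]))).
  apply/seteqP; split=> w E s st; have [Eb Eg] := E s st.
    by split=> i _; [apply: Eb|apply: Eg].
  by split=> *; [apply: (Eb (_, _, _))|apply: (Eg (_, _))].
apply: fin_bigcap_measurable => // s _; apply: measurableI.
  by apply: fin_bigcap_measurable => // i _; apply: measurable_funPTI.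
by apply: fin_bigcap_measurable => // i _; apply: measurable_funPTI.
Qed.

Fixpoint pasts (t : nat) : seq (seq slot) :=
  if t is s.+1 then [seq rcons x o | x <- pasts s, o <- enum slot]
  else [:: [::]].

Lemma size_pasts t x : x \in pasts t -> size x = t.
Proof.
elim: t x => [|t IH] x; first by rewrite inE => /eqP ->.
by move=> /allpairsP[[y o] [/IH ty _ ->]]; rewrite size_rcons ty.
Qed.

Lemma sum_pasts (f : seq slot -> R) w t :
  \sum_(x <- pasts t) f x * \1_(cylinder x) w = f (past w t).
Proof.
elim: t f => [|t IH] f.
  rewrite big_seq1 indicE mem_set ?mulr1//=.
rewrite /= big_allpairs_dep /= -[past w t.+1]/(mkseq _ _) mkseqS.
rewrite -(IH (fun x => f (rcons x (slot_of w t)))).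
rewrite !big_seq; apply: eq_bigr => x /size_pasts tx.
(* Among the extensions of [x], only the one by the actual outcome of slot [t] can contain [w]. *)
rewrite big_enum /= (bigD1 (slot_of w t))//= big1 ?addr0.
  congr (_ * _); rewrite !indicE; congr (_%:R); congr (nat_of_bool _).
  apply/idP/idP; rewrite !inE !cylinderP size_rcons tx /past mkseqS.
    by move=> /rcons_inj[].
  by move=> {1}->.
move=> o /eqP neq; rewrite indicE memNset ?mulr0// cylinderP size_rcons tx.
by rewrite /past mkseqS => /rcons_inj[_]; exact: neq.
Qed.

Definition past_mean (t : nat) (f : seq slot -> R) : R :=
  \sum_(x <- pasts t) f x * fine (P (cylinder x)).

(** The past takes finitely many values, so the integral splits over cylinders; nonnegativity
    justifies the exchange. *)
Lemma expectation_past t (f : seq slot -> R) : (forall x, 0 <= f x) ->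
  ('E_P[fun w => f (past w t)] = (past_mean t f)%:E)%E.
Proof.
move=> f0; rewrite unlock /past_mean -sumEFin.
under eq_integral do rewrite -sum_pasts -sumEFin.
rewrite ge0_integral_sum//=.
- apply: eq_bigr => x _.
  under eq_integral do rewrite EFinM.
  rewrite ge0_integralZl_EFin//.
  + rewrite integral_indic ?setIT//; last exact: measurable_history.
    by rewrite EFinM fineK// fin_num_measure//; apply: measurable_history.
  + by apply/measurable_EFinP; apply: measurable_indic; apply: measurable_history.
- move=> x; apply/measurable_EFinP; apply: measurable_funM => //.
  by apply: measurable_indic; apply: measurable_history.
- by move=> x w _; rewrite lee_fin mulr_ge0.
Qed.

Lemma past_mean0 f : past_mean 0 f = f [::].
Proof.
rewrite /past_mean big_seq1 (_ : cylinder [::] = setT) ?probability_setT ?mulr1//.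
by apply/seteqP; split.
Qed.

Lemma ler_past_mean t f g : (forall x, size x = t -> f x <= g x) -> past_mean t f <= past_mean t g.
Proof.
move=> fg; rewrite /past_mean !big_seq; apply: ler_sum => x /size_pasts tx.
by rewrite ler_wpM2r ?fine_ge0// fg.
Qed.

Lemma eq_past_mean t f g : (forall x, size x = t -> f x = g x) -> past_mean t f = past_mean t g.
Proof.
by move=> fg; apply/le_anti/andP; split; apply: ler_past_mean => x tx; rewrite fg.
Qed.

Lemma past_meanD t f g : past_mean t (fun x => f x + g x) = past_mean t f + past_mean t g.
Proof. by rewrite /past_mean -big_split; apply: eq_bigr => x _; rewrite mulrDl. Qed.

Lemma past_meanZ t c f : past_mean t (fun x => c * f x) = c * past_mean t f.
Proof. by rewrite /past_mean mulr_sumr; apply: eq_bigr => x _; rewrite mulrA. Qed.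

Section chain_rule.
Context (tie : tie_rule) (b : 'I_2 -> 'I_2 -> R) (r : 'I_2 -> R) (z : nat).
Hypothesis hproc : nsr_process beta gamma tie b r z.

(** The chain rule [nsr_law] enters here; the recursions in time below all start from this
    identity. *)
Lemma past_meanS t f : past_mean t.+1 f =
  past_mean t (fun x => \sum_o step_weight R tie b r z x o * f (rcons x o)).
Proof.
rewrite /past_mean /= big_allpairs_dep; apply: eq_bigr => x _.
rewrite big_enum mulr_suml; apply: eq_bigr => o _.
rewrite /cylinder size_rcons (nsr_law hproc) history_rcons fineM//; last first.
  by apply: fin_num_measure; apply: measurable_history.
by rewrite /step_weight /=; ring.
Qed.

Lemma past_mean1 t : past_mean t (fun=> 1) = 1.
Proof.
elim: t => [|t IH]; first by rewrite past_mean0.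
rewrite past_meanS -[RHS]IH; apply: eq_past_mean => x _.
by under eq_bigr do rewrite mulr1; rewrite sum_step_weight.
Qed.

Lemma past_mean_cst t c : past_mean t (fun=> c) = c.
Proof. by rewrite -[RHS]mulr1 -(past_mean1 t) -past_meanZ; apply: eq_past_mean => *; rewrite mulr1. Qed.

End chain_rule.

Lemma mean_hE m k t : mean_h beta gamma m k t = (past_mean t (fun x => (h_of x m k)%:R))%:E.
Proof.
rewrite -expectation_past// /mean_h; congr expectation; apply/funext => w.
congr (_%:R); rewrite /h_of size_mkseq; apply: h_aoi_ext => s st.
by split=> *; rewrite /path_requests /path_commands (req_of_past, cmd_of_past).
Qed.

End process_law.

(** * The truncated chain *)

Section rates.
Context (R : realType) (tie : tie_rule) (b : 'I_2 -> 'I_2 -> R)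
  (r : 'I_2 -> R) (Bmax Rmax : R) (z : nat).
Hypothesis hpar : nsr_parameters b r Bmax Rmax.

(** The rates only compare ages with each other and with [z], so ages above [z] may be clipped. This
    makes the truncated chain autonomous. *)
Lemma rate_minn k a1 a2 :
  rate tie r z k (minn a1 z) (minn a2 z) = rate tie r z k a1 a2.
Proof.
have -> : rate tie r z k a1 a2 =
  if (if tie is ties_even then a1 == a2 else false) then rtot r / 2 else
  if (a2 <= a1)%N && (a2 < z)%N then r k
  else if (a1 < a2)%N && (a1 < z)%N then rtot r - r k else rtot r / 2.
  by rewrite /rate; case: tie.
have -> : rate tie r z k (minn a1 z) (minn a2 z) =
  if (if tie is ties_even then minn a1 z == minn a2 z else false) then rtot r / 2 else
  if (minn a2 z <= minn a1 z)%N && (minn a2 z < z)%N then r k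
  else if (minn a1 z < minn a2 z)%N && (minn a1 z < z)%N then rtot r - r k
  else rtot r / 2.
  by rewrite /rate; case: tie.
have -> : ((minn a2 z <= minn a1 z) && (minn a2 z < z))%N =
  ((a2 <= a1) && (a2 < z))%N by lia.
have -> : ((minn a1 z < minn a2 z) && (minn a1 z < z))%N =
  ((a1 < a2) && (a1 < z))%N by lia.
case: tie => //=.
case: (eqVneq a1 a2) => [->|neq]; first by rewrite eqxx.
(* Distinct ages that become tied by clipping are both at least [z], where the rate is [rtot r / 2]
   in any case. *)
case: (eqVneq (minn a1 z) (minn a2 z)) => // E.
have -> : ((a2 <= a1) && (a2 < z))%N = false by lia.
by have -> : ((a1 < a2) && (a1 < z))%N = false by lia.
Qed.

(** Since [rtot r - r k] is the parameter of the other CP, every rate is [r i1], [r i2] or their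
    midpoint. *)
Lemma rate_bounds k a1 a2 : r i2 <= rate tie r z k a1 a2 <= 1.
Proof.
have := nsr_r hpar i1; have := nsr_r hpar i2; have := nsr_r_le hpar.
rewrite /rate /rtot big_I2 /= => h21 /andP[? ?] /andP[? ?].
by case: (I2P k) => ->; case: tie; do ?case: ifP => _; apply/andP; split; lra.
Qed.

Lemma zeta_bounds n k : 0 <= zeta b n k <= 1.
Proof. by have /andP[? ?] := nsr_b hpar n k; rewrite /zeta /zetabar; nra. Qed.

Lemma zeta_gt0 n k : 0 < b n k -> 0 < zeta b n k.
Proof. by have /andP[? ?] := nsr_b hpar n k; rewrite /zeta /zetabar; nra. Qed.

Lemma zeta_eq0 n k : b n k <= 0 -> zeta b n k = 0.
Proof.
have /andP[b0 _] := nsr_b hpar n k => bn; have -> : zeta b n k = 1 - (1 - b n k) ^+ 2 by [].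
by have -> : b n k = 0 by [lra]; rewrite subr0 expr1n subrr.
Qed.

Lemma hit_bounds n k a1 a2 :
  r i2 * zeta b n k <= rate tie r z k a1 a2 * zeta b n k <= 1.
Proof.
have /andP[? ?] := zeta_bounds n k; have /andP[? ?] := rate_bounds k a1 a2.
by have /andP[? ?] := nsr_r hpar i2; nra.
Qed.

End rates.

Section truncated_chain.
Context (R : realType) (tie : tie_rule) (b : 'I_2 -> 'I_2 -> R)
  (r : 'I_2 -> R) (z' : nat) (n : 'I_2).
Local Notation z := z'.+2.

(** The index of a truncated age, shifted by one as in [state]. Writing the threshold as [z'.+2]
    builds in that it is at least 2. *)
Definition clip (a : nat) : 'I_z := inord (minn a z).-1.
Definition clip2 (a1 a2 : nat) : state z := (clip a1, clip a2).

Definition trans_op (f : state z -> R) (phi : state z) : R :=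
  \sum_phi' trans tie b r n phi phi' * f phi'.

Definition reset_prob (phi : state z) (k : 'I_2) : R :=
  rate tie r z k (age phi i1) (age phi i2) * zeta b n k.

Lemma clipS a : (0 < a)%N -> (clip a).+1 = minn a z.
Proof. by move=> a0; rewrite inordK; lia. Qed.

Lemma clip_grow a : (0 < a)%N -> clip (clip a).+2 = clip a.+1.
Proof. by move=> a0; congr inord; rewrite clipS//; lia. Qed.

Lemma sum_reset_grow (phi : 'I_z) (f : 'I_z -> R) (u v : R) :
  \sum_(i < z) ((i.+1 == 1%N)%:R * u + (i.+1 == minn phi.+2 z)%:R * v) * f i =
  u * f (clip 1) + v * f (clip phi.+2).
Proof.
under eq_bigr do rewrite mulrDl; rewrite big_split /=; congr (_ + _).
  rewrite (bigD1 (clip 1))//= big1 ?addr0.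
    by rewrite clipS// mul1r.
  move=> i; rewrite -val_eqE/= => ne; have := clipS 1 isT => E.
  by rewrite (_ : (i.+1 == 1)%N = false) ?mul0r//; lia.
rewrite (bigD1 (clip phi.+2))//= big1 ?addr0.
  by rewrite clipS// eqxx mul1r.
move=> i; rewrite -val_eqE/= => ne; have := clipS phi.+2 isT => E.
by rewrite (_ : (i.+1 == minn phi.+2 z)%N = false) ?mul0r//; lia.
Qed.

(** Each matrix entry factors over the two coordinates, a miss having probability one minus that of
    a hit. *)
Lemma trans_opE f phi : trans_op f phi =
  reset_prob phi i1 * (reset_prob phi i2 * f (clip2 1 1) +
     (1 - reset_prob phi i2) * f (clip2 1 (age phi i2).+1)) +
  (1 - reset_prob phi i1) * (reset_prob phi i2 * f (clip2 (age phi i1).+1 1) +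
     (1 - reset_prob phi i2) * f (clip2 (age phi i1).+1 (age phi i2).+1)).
Proof.
have transE phi' : trans tie b r n phi phi' =
    ((phi'.1.+1 == 1%N)%:R * reset_prob phi i1 +
     (phi'.1.+1 == minn phi.1.+2 z)%:R * (1 - reset_prob phi i1)) *
    ((phi'.2.+1 == 1%N)%:R * reset_prob phi i2 +
     (phi'.2.+1 == minn phi.2.+2 z)%:R * (1 - reset_prob phi i2)).
  rewrite /trans -/(reset_prob phi i1) -/(reset_prob phi i2).
  have missE k : (1 - rate tie r z k (age phi i1) (age phi i2)) * zeta b n k +
     zetabar b n k = 1 - reset_prob phi k by rewrite /reset_prob /zeta; ring.
  rewrite !missE /age/=.
  (* A grown age is at least 2 because the threshold is, so growth and reset never coincide and the
     cases of [trans] are exclusive. *)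
  have D1 : (phi'.1.+1 == 1%N) && (phi'.1.+1 == minn phi.1.+2 z) = false by lia.
  have D2 : (phi'.2.+1 == 1%N) && (phi'.2.+1 == minn phi.2.+2 z) = false by lia.
  move: D1 D2; do 4 case: (_ == _) => //=; rewrite ?(mul1r, mul0r, addr0, add0r, mulr0)//.
rewrite /trans_op; under eq_bigr do rewrite transE.
rewrite sum_prod/=.
rewrite -(sum_reset_grow phi.1 (fun i => reset_prob phi i2 * f (i, clip 1) +
     (1 - reset_prob phi i2) * f (i, clip (age phi i2).+1))).
apply: eq_bigr => i _; rewrite -(sum_reset_grow phi.2 (fun j => f (i, j))).
by rewrite mulr_sumr; apply: eq_bigr => j _; rewrite mulrA.
Qed.

Lemma trans_op_affine c f e : trans_op (fun phi => c * f phi + e) = (fun phi => c * trans_op f phi + e).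
Proof. by apply/funext => phi; rewrite !trans_opE; ring. Qed.

Lemma op_clip2 f a1 a2 : (0 < a1)%N -> (0 < a2)%N ->
  let h k := rate tie r z k a1 a2 * zeta b n k in
  trans_op f (clip2 a1 a2) =
  h i1 * (h i2 * f (clip2 1 1) + (1 - h i2) * f (clip2 1 a2.+1)) +
  (1 - h i1) * (h i2 * f (clip2 a1.+1 1) + (1 - h i2) * f (clip2 a1.+1 a2.+1)).
Proof.
move=> a10 a20 h; have hE k : reset_prob (clip2 a1 a2) k = h k.
  by rewrite /reset_prob /age/= !clipS// rate_minn.
by rewrite trans_opE !hE /clip2 /age/= !clip_grow.
Qed.

Definition state_of (x : seq slot) : state z := clip2 (g_of x n i1) (g_of x n i2).

(** Clipping commutes with growth and preserves the rates, so the clipped true ages move according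
    to [trans]. *)
Lemma sum_step_state x f :
  \sum_o step_weight R tie b r z x o * f (state_of (rcons x o)) =
  trans_op f (state_of x).
Proof.
rewrite (sum_step_g R tie b r z x n (fun a1 a2 => f (clip2 a1 a2))).
by rewrite op_clip2// /g_of g_aoi_gt0.
Qed.

(* The product g * F increases in mean by [trans_op F - g], whereas both
   sums over one reception cycle of length L equal L (L + 1) / 2. *)
Lemma sum_step_age_reception x k F :
  reception_system (trans tie b r n) k F ->
  \sum_o step_weight R tie b r z x o *
     ((g_of (rcons x o) n k)%:R * F (state_of (rcons x o))) =
  trans_op F (state_of x) + (g_of x n k)%:R * (F (state_of x) - 1).
Proof.
move=> /(_ (state_of x)) FE.
(* The restriction to unreset states becomes a 0-1 factor, so that [op_clip2] expands both terms
   alike. *)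
have {FE} -> : F (state_of x) - 1 =
    trans_op (fun phi => (age phi k != 1%N)%:R * F phi) (state_of x).
  rewrite FE addrC addKr big_mkcond; apply: eq_bigr => phi _.
  by case: ifP; rewrite ?mul1r// mul0r mulr0.
have g0 j : (0 < g_of x n j)%N by rewrite /g_of g_aoi_gt0.
have N1 : clip 1 = 0%N :> nat by have := clipS 1 isT; lia.
have NS a : (0 < a)%N -> ((clip a.+1).+1 == 1)%N = false.
  by move=> a0; rewrite clipS//; lia.
case: (I2P k) => ->.
  rewrite (sum_step_g R tie b r z x n (fun a1 a2 => a1%:R * F (clip2 a1 a2))).
  rewrite !op_clip2// /rate_of /age/= N1 !NS// eqxx /= -natr1; ring.
rewrite (sum_step_g R tie b r z x n (fun a1 a2 => a2%:R * F (clip2 a1 a2))).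
rewrite !op_clip2// /rate_of /age/= N1 !NS// eqxx /= -natr1; ring.
Qed.

End truncated_chain.

(** * Doeblin mixing and nonnegativity of reception times *)

Section mixing.
Context (R : realType) (tie : tie_rule) (b : 'I_2 -> 'I_2 -> R)
  (r : 'I_2 -> R) (Bmax Rmax : R) (z' : nat) (n : 'I_2).
Local Notation z := z'.+2.
Hypothesis hpar : nsr_parameters b r Bmax Rmax.
Hypothesis hr2 : 0 < r i2.

Local Notation op := (trans_op R tie b r z' n).
Local Notation hit := (reset_prob R tie b r z' n).
Local Notation clip := (clip z').
Local Notation clip2 := (clip2 z').

(** The common state of the Doeblin argument, coordinate by coordinate; [weight] bounds from below
    the chance of entering it in the last step. *)
Definition target (k : 'I_2) : 'I_z := if 0 < b n k then clip 1 else clip z.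
Definition weight (k : 'I_2) : R := if 0 < b n k then r i2 * zeta b n k else 1.
Definition minor : R := weight i1 * weight i2.

Lemma hit01 phi k : 0 <= hit phi k <= 1.
Proof.
have /andP[h1 ->] := hit_bounds R tie b r Bmax Rmax z hpar n k (age phi i1) (age phi i2).
rewrite andbT; apply: le_trans h1; apply: mulr_ge0; first exact: ltW.
by case/andP: (zeta_bounds R b r Bmax Rmax hpar n k).
Qed.

Lemma hit_ge_weight phi k : 0 < b n k -> weight k <= hit phi k.
Proof.
move=> bk; rewrite /weight bk.
by have /andP[] := hit_bounds R tie b r Bmax Rmax z hpar n k (age phi i1) (age phi i2).
Qed.

Lemma hit_eq0 phi k : b n k <= 0 -> hit phi k = 0.
Proof. by move=> bk; rewrite /reset_prob (zeta_eq0 R b r Bmax Rmax)// mulr0. Qed.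

Lemma weight_bounds k : 0 < weight k <= 1.
Proof.
rewrite /weight; case: ifP => [bk|_]; last by rewrite ltr01 lexx.
rewrite mulr_gt0//=; last exact: (zeta_gt0 R b r Bmax Rmax).
have /andP[? ?] := nsr_r hpar i2.
by have /andP[? ?] := zeta_bounds R b r Bmax Rmax hpar n k; nra.
Qed.

Lemma minor_bounds : 0 < minor <= 1.
Proof.
have /andP[? ?] := weight_bounds i1; have /andP[? ?] := weight_bounds i2.
by rewrite /minor mulr_gt0//=; nra.
Qed.

(** [op] averages over the successors; a reset of coordinate [k] has probability 0 unless [b n k] is
    positive, so it is only examined then. *)
Lemma le_op c f phi :
  (forall a1 a2,
     a1 = (age phi i1).+1 \/ a1 = 1%N /\ 0 < b n i1 ->
     a2 = (age phi i2).+1 \/ a2 = 1%N /\ 0 < b n i2 ->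
     c <= f (clip2 a1 a2)) ->
  c <= op f phi.
Proof.
move=> cf; rewrite trans_opE.
have avg (k : 'I_2) (u v : R) : (0 < b n k -> c <= u) -> c <= v ->
    c <= hit phi k * u + (1 - hit phi k) * v.
  move=> cu cv; case: (ltP 0 (b n k)) => [/cu {}cu|/hit_eq0 ->]; last lra.
  by have /andP[? ?] := hit01 phi k; nra.
by apply: (avg) => [b1|]; apply: (avg) => [b2|]; apply: cf; do ?[by left|by right].
Qed.

(** The last step: requested coordinates reset, with probability at least [weight], while the others
    surely grow to the threshold. *)
Lemma op_target f phi : (forall psi, 0 <= f psi) ->
  (forall k, b n k <= 0 -> (z <= (age phi k).+1)%N) ->
  minor * f (target i1, target i2) <= op f phi.
Proof.
move=> f0 Hz; rewrite trans_opE /minor.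
have avg (k : 'I_2) (u v c : R) : 0 <= u -> 0 <= v ->
    c <= (if 0 < b n k then u else v) ->
    weight k * c <= hit phi k * u + (1 - hit phi k) * v.
  have /andP[w0 w1] := weight_bounds k; have := hit_ge_weight phi k.
  have /andP[h0 h1] := hit01 phi k => + u0 v0.
  case: (ltP 0 (b n k)) => bk => [/(_ isT) wh cu|_ cv]; last first.
    by rewrite hit_eq0 // /weight ltNge bk /=; lra.
  have := ler_wpM2l (ltW w0) cu; have := ler_wpM2r u0 wh; nra.
have tgt k : b n k <= 0 -> clip (age phi k).+1 = clip z.
  by move=> /Hz zk; congr inord; lia.
have pos k u v : 0 <= u -> 0 <= v -> 0 <= hit phi k * u + (1 - hit phi k) * v.
  by have /andP[? ?] := hit01 phi k; move=> ? ?; nra.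
rewrite -mulrA; apply: (avg); [exact: pos|exact: pos|].
rewrite /target; case: (ltP 0 (b n i1)) => b1; apply: (avg) => //;
  case: (ltP 0 (b n i2)) => b2; rewrite /clip2 ?(tgt i1)// ?(tgt i2)//.
Qed.

Lemma iter_op_target f : (forall psi, 0 <= f psi) -> forall j phi,
  (forall k, b n k <= 0 -> (z <= age phi k + j.+1)%N) ->
  minor * f (target i1, target i2) <= iter j.+1 op f phi.
Proof.
move=> f0; elim=> [|j IH] phi Hz.
  by apply: op_target => // k /Hz; rewrite addn1.
(* The outer [op] is the first step of the chain. Whatever it does, a coordinate that cannot be
   reset comes one closer to the threshold. *)
rewrite iterS; apply: le_op => a1 a2 H1 H2; apply: IH => k bk.
have ak : age (clip2 a1 a2) k = minn (age phi k).+1 z.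
  rewrite /age /=; case: (I2P k) bk => -> bk /=.
    by case: H1 => [->|[_]]; [rewrite clipS|rewrite ltNge bk].
  by case: H2 => [->|[_]]; [rewrite clipS|rewrite ltNge bk].
by have := Hz k bk; rewrite ak; lia.
Qed.

Lemma iter_op_affine j c f e :
  iter j op (fun phi => c * f phi + e) = (fun phi => c * iter j op f phi + e).
Proof. by elim: j => //= j ->; rewrite trans_op_affine. Qed.

(** Every start gives mass at least [minor] to the same value [v], which pulls both ends of the
    range towards [v]. *)
Lemma iter_op_contract f m M : (forall phi, m <= f phi <= M) ->
  exists m' M', (forall phi, m' <= iter z op f phi <= M') /\
    M' - m' = (1 - minor) * (M - m).
Proof.
move=> mM; set v := f (target i1, target i2).
exists (m + minor * (v - m)), (M - minor * (M - v)); split; last ring.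
move=> phi; have Hz k : b n k <= 0 -> (z <= age phi k + z)%N by rewrite leq_addl.
(* [f - m] and [M - f] are nonnegative; their affine form lets [iter_op_affine] carry them through
   the iterates. *)
have lo : forall psi, 0 <= 1 * f psi + - m by move=> psi; have := mM psi; lra.
have hi : forall psi, 0 <= -1 * f psi + M by move=> psi; have := mM psi; lra.
have := iter_op_target _ lo z'.+1 phi Hz.
have := iter_op_target _ hi z'.+1 phi Hz.
rewrite !iter_op_affine -/v; lra.
Qed.

Lemma iter_op_oscillation f j : exists m M,
  (forall phi, m <= iter (z * j) op f phi <= M) /\
  M - m = (1 - minor) ^+ j * (2 * \sum_phi `|f phi|).
Proof.
elim: j => [|j [m [M [mM E]]]].
  exists (- \sum_phi `|f phi|), (\sum_phi `|f phi|); split; last by rewrite expr0; ring.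
  move=> phi; rewrite muln0 -ler_norml /= (bigD1 phi)//= lerDl.
  exact: sumr_ge0.
have [m' [M' [mM' E']]] := iter_op_contract _ _ _ mM.
exists m', M'; split; last by rewrite E' E exprS mulrA.
by move=> phi; rewrite mulnS iterD.
Qed.

Section stationary.
Context (pi : state z -> R).
Hypothesis hpi : steady_state (trans tie b r n) pi.

Lemma steady_iter_op f j :
  \sum_phi iter j op f phi * pi phi = \sum_phi f phi * pi phi.
Proof.
elim: j => //= j <-; set g := iter j op f.
rewrite /trans_op; under eq_bigr do rewrite mulr_suml.
rewrite exchange_big; apply: eq_bigr => phi' _ /=.
rewrite [in RHS](steady_eq hpi) mulr_sumr; apply: eq_bigr => phi _; ring.
Qed.

Lemma steady_between f m M : (forall phi, m <= f phi <= M) ->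
  m <= \sum_phi f phi * pi phi <= M.
Proof.
move=> mM; rewrite -[m]mulr1 -[M]mulr1 -(steady_sum1 hpi) !mulr_sumr.
by apply/andP; split; apply: ler_sum => phi _; rewrite ler_wpM2r ?(steady_ge0 hpi)//;
  case/andP: (mM phi).
Qed.

End stationary.

(** Minimum principle: at a minimiser with negative value, replacing reset values by 0 only raises
    the average, so the system would give [F phi >= 1 + F phi]. *)
Lemma reception_ge0 k (F : state z -> R) : reception_system (trans tie b r n) k F ->
  forall phi, 0 <= F phi.
Proof.
move=> FE; case: (@arg_minP _ _ _ ((ord0, ord0) : state z) xpredT F) => // phi _ minF psi.
apply: le_trans (minF psi isT); rewrite leNgt; apply/negP => neg.
have := FE phi; rewrite big_mkcond /=.
rewrite (eq_bigr (fun phi' => trans tie b r n phi phi' *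
   ((age phi' k != 1%N)%:R * F phi'))); last first.
  by move=> phi' _; case: ifP; rewrite ?mul1r// mul0r mulr0.
rewrite -/(op (fun phi' => (age phi' k != 1%N)%:R * F phi') phi) => E.
have : F phi <= op (fun phi' => (age phi' k != 1%N)%:R * F phi') phi.
  apply: le_op => a1 a2 _ _; case: (_ != _); rewrite ?mul1r ?mul0r ?minF//.
  exact: ltW.
by lra.
Qed.

End mixing.

(** * Mean ages and the two bounds *)

Section ages.
Context (R : realType) (d : measure_display) (T : measurableType d)
  (P : probability T R)
  (beta : 'I_2 -> 'I_2 -> 'I_2 -> nat -> {RV P >-> bool})
  (gamma : 'I_2 -> 'I_2 -> nat -> {RV P >-> bool})
  (tie : tie_rule) (b : 'I_2 -> 'I_2 -> R) (r : 'I_2 -> R)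
  (Bmax Rmax : R) (z' : nat).
Local Notation z := z'.+2.
Hypothesis hpar : nsr_parameters b r Bmax Rmax.
Hypothesis hb : forall k, 0 < btot b k.
Hypothesis hr2 : 0 < r i2.
Hypothesis hproc : nsr_process beta gamma tie b r z.

Local Notation past_mean := (past_mean R d T P beta gamma).
Local Notation op := (trans_op R tie b r z').
Local Notation state_of := (state_of z').
Local Notation step_weight := (step_weight R tie b r z).
Let past_mean_step := past_meanS R d T P beta gamma tie b r z hproc.
Let past_mean_const := past_mean_cst R d T P beta gamma tie b r z hproc.

Definition mean_g n k t : R := past_mean t (fun x => (g_of x n k)%:R).
Definition mean_hr m k t : R := past_mean t (fun x => (h_of x m k)%:R).
Definition mean_state n (f : state z -> R) t : R :=
  past_mean t (fun x => f (state_of n x)).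

(** Tower property: the last [j] slots are averaged out by [j] applications of the operator. *)
Lemma mean_state_iter n f i j :
  mean_state n f (i + j) = mean_state n (iter j (op n) f) i.
Proof.
elim: j f => [|j IH] f; first by rewrite addn0.
rewrite addnS iterSr -IH /mean_state past_mean_step; apply: eq_past_mean => x _.
exact: sum_step_state.
Qed.

Lemma mean_state_between n f m M t : (forall phi, m <= f phi <= M) ->
  m <= mean_state n f t <= M.
Proof.
move=> mM; rewrite -[m](past_mean_const t) -[M](past_mean_const t).
by apply/andP; split; apply: ler_past_mean => x _; case/andP: (mM (state_of n x)).
Qed.

(** For [t >= z * j], both the mean at [t] and the stationary mean lie in the range of the
    [z * j]-fold iterate, whose width tends to 0. *)
Lemma mean_state_cvg n f pi : steady_state (trans tie b r n) pi ->
  mean_state n f t @[t --> \oo] --> \sum_phi f phi * pi phi.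
Proof.
move=> hpi; apply/cvgrPdist_lt => e e0.
have /andP[w0 w1] := minor_bounds R b r Bmax Rmax n hpar hr2.
set q := 1 - minor R b r n; set C := 2 * \sum_phi `|f phi|.
have /cvgr0Pnorm_lt/(_ e e0) [j _ Hj] : (q ^+ j * C) @[j --> \oo] --> (0 : R).
  rewrite -[X in _ --> X](mul0r C); apply: cvgM; last exact: cvg_cst.
  by apply: cvg_expr; rewrite /q ger0_norm; lra.
exists (z * j)%N => // t /= zjt.
have [m [M [mM E]]] := iter_op_oscillation R tie b r Bmax Rmax z' n hpar hr2 f j.
have /andP[? ?] := steady_between R tie b r z' n pi hpi _ _ _ mM.
have := mean_state_between n _ _ _ (t - z * j) mM.
rewrite -mean_state_iter subnK// => /andP[? ?].
have S : \sum_phi iter (z * j) (op n) f phi * pi phi = \sum_phi f phi * pi phi.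
  exact: steady_iter_op.
have := Hj j (leqnn j); rewrite /= -/q -E => lt.
apply: le_lt_trans (lt); apply: le_trans (ler_norm _).
by rewrite -S ler_norml; lra.
Qed.

Lemma sum_mean_g n k F N : reception_system (trans tie b r n) k F ->
  \sum_(0 <= t < N) mean_g n k t <=
  F (clip2 z' 1 1) + \sum_(0 <= t < N) mean_state n F t.+1.
Proof.
(* The increments of [V] trade [mean_g] for [mean_state]. It starts at F of the ages (1,1), and its
   nonnegative final value is dropped. *)
move=> FE; pose V t := past_mean t (fun x => (g_of x n k)%:R * F (state_of n x)).
have F0 := reception_ge0 R tie b r Bmax Rmax z' n hpar hr2 k F FE.
have V0 t : 0 <= V t.
  by rewrite -[0](past_mean_const t); apply: ler_past_mean => x _; rewrite mulr_ge0.
have VS t : V t.+1 = mean_state n F t.+1 + V t - mean_g n k t.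
  suff : V t.+1 + mean_g n k t = mean_state n F t.+1 + V t by lra.
  rewrite /V /mean_state /mean_g !past_mean_step -!past_meanD.
  apply: eq_past_mean => x _; rewrite sum_step_age_reception// sum_step_state; ring.
have VE : \sum_(0 <= t < N) mean_g n k t =
    V 0%N - V N + \sum_(0 <= t < N) mean_state n F t.+1.
  elim: N => [|N IH]; first by rewrite !big_geq// subrr addr0.
  by rewrite !big_nat_recr//= IH VS; ring.
have V00 : V 0%N = F (clip2 z' 1 1) by rewrite /V past_mean0 mul1r.
by rewrite VE V00; have := V0 N; lra.
Qed.

Lemma rate_of_bounds x n k : r i2 <= rate_of R tie r z x n k <= 1.
Proof. exact: (rate_bounds R tie b r Bmax Rmax). Qed.

Lemma r2_bounds : 0 < r i2 <= 1.
Proof. by rewrite hr2; case/andP: (nsr_r hpar i2). Qed.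

(** The bound is the fixed point of [x -> 1 + (1 - btot b k * r i2) x], and the initial age 1 lies
    below it. *)
Lemma mean_hr_le m k t : mean_hr m k t <= (btot b k * r i2)^-1.
Proof.
have /andP[r20 r21] := r2_bounds; have bk := hb k; have bk1 := nsr_btot hpar k.
have br0 : 0 < btot b k * r i2 by rewrite mulr_gt0.
have br1 : btot b k * r i2 <= 1 by nra.
elim: t => [|t IH]; first by rewrite /mean_hr past_mean0 invf_ge1.
have : mean_hr m k t.+1 <= 1 + (1 - btot b k * r i2) * mean_hr m k t.
  rewrite /mean_hr past_mean_step -[X in _ <= X + _](past_mean_const t) -past_meanZ -past_meanD; apply: ler_past_mean => x _.
  rewrite sum_step_h -!natr1.
  have /andP[? ?] := nsr_b hpar i1 k; have /andP[? ?] := nsr_b hpar i2 k.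
  (* With command probability p, a request leads to mean age 1 + (1 - p) min(h, g), where p is at
     least [r i2]. *)
  have H n : b n k * (rate_of R tie r z x n k + (1 - rate_of R tie r z x n k) *
      ((minn (h_of x m k) (g_of x n k))%:R + 1)) <=
      b n k * (1 + (1 - r i2) * (h_of x m k)%:R).
    have /andP[? ?] := nsr_b hpar n k; apply: ler_wpM2l => //.
    have /andP[? ?] := rate_of_bounds x n k.
    have : (minn (h_of x m k) (g_of x n k))%:R <= (h_of x m k)%:R :> R.
      by rewrite ler_nat geq_minl.
    have : 0 <= (h_of x m k)%:R :> R by [].
    nra.
  have := H i1; have := H i2; rewrite /btot big_I2 /=; lra.
move/le_trans; apply.
have : (1 - btot b k * r i2) * mean_hr m k t <=
    (1 - btot b k * r i2) * (btot b k * r i2)^-1 by rewrite ler_wpM2l// subr_ge0.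
by rewrite [leRHS]mulrBl mul1r mulfV ?gt_eqF//; lra.
Qed.

Lemma mean_hr_le_g m k t : mean_hr m k t.+1 <=
  (1 - btot b k + btot b k * r i2) / (btot b k * r i2) +
  (1 - r i2) * \sum_(n < 2) b n k * mean_g n k t.
Proof.
have /andP[r20 r21] := r2_bounds; have bk := hb k; have bk1 := nsr_btot hpar k.
have br0 : 0 < btot b k * r i2 by rewrite mulr_gt0.
have : mean_hr m k t.+1 <= 1 + (1 - btot b k) * mean_hr m k t +
    (1 - r i2) * \sum_(n < 2) b n k * mean_g n k t.
  rewrite big_I2 /= /mean_hr /mean_g past_mean_step -[X in _ <= X + _ + _](past_mean_const t) -!past_meanZ -!past_meanD -!past_meanZ -!past_meanD.
  apply: ler_past_mean => x _; rewrite sum_step_h -!natr1.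
  have H n : b n k * (rate_of R tie r z x n k + (1 - rate_of R tie r z x n k) *
      ((minn (h_of x m k) (g_of x n k))%:R + 1)) <=
      b n k * (1 + (1 - r i2) * (g_of x n k)%:R).
    have /andP[? ?] := nsr_b hpar n k; apply: ler_wpM2l => //.
    have /andP[? ?] := rate_of_bounds x n k.
    have : (minn (h_of x m k) (g_of x n k))%:R <= (g_of x n k)%:R :> R.
      by rewrite ler_nat geq_minr.
    have : 0 <= (g_of x n k)%:R :> R by [].
    nra.
  have := H i1; have := H i2; rewrite /btot big_I2 /=; lra.
(* The constant is 1 + (1 - b_k) / (b_k r_2), obtained by inserting [mean_hr_le] for the slots
   without a request. *)
move/le_trans; apply; rewrite lerD2r [leRHS]mulrDl mulfV ?gt_eqF//.
rewrite [leLHS]addrC lerD2r.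
by rewrite ler_wpM2l ?subr_ge0// mean_hr_le.
Qed.

(** * Time averages and their limits *)

Definition sample_mean (u : nat -> R) (N : nat) : R :=
  N.+1%:R^-1 * \sum_(0 <= t < N.+1) u t.

(** The index [N.+1] avoids division by zero; summing at [t.+1] matches [mean_hr_le_g], which bounds
    slot [t.+1] by slot [t]. *)
Lemma avg_aoiE N : avg_aoi beta gamma N.+1 =
  (sample_mean (fun t => 4^-1 * \sum_(m < 2) \sum_(k < 2) mean_hr m k t.+1) N)%:E.
Proof.
rewrite /avg_aoi /sample_mean big_add1 /= EFinM -sumEFin; congr (_ * _)%E.
apply: eq_bigr => t _; rewrite EFinM -sumEFin; congr (_ * _)%E.
apply: eq_bigr => m _; rewrite -sumEFin; apply: eq_bigr => k _.
exact: mean_hE.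
Qed.

Lemma ler_sample_mean u v N : (forall t, u t <= v t) ->
  sample_mean u N <= sample_mean v N.
Proof. by move=> uv; rewrite ler_wpM2l// ler_sum. Qed.

Lemma sample_mean_cst c N : sample_mean (fun=> c) N = c.
Proof.
by rewrite /sample_mean sumr_const_nat subn0 -[X in _ * X]mulr_natl mulKf// pnatr_eq0.
Qed.

Lemma sample_meanD u v N :
  sample_mean (fun t => u t + v t) N = sample_mean u N + sample_mean v N.
Proof. by rewrite /sample_mean big_split mulrDr. Qed.

Lemma sample_meanZ c u N :
  sample_mean (fun t => c * u t) N = c * sample_mean u N.
Proof. by rewrite /sample_mean -mulr_sumr; ring. Qed.

Lemma average_user_le (Y : 'I_2 -> R) t :
  (forall m k, mean_hr m k t <= Y k) ->
  4^-1 * \sum_(m < 2) \sum_(k < 2) mean_hr m k t <= 2^-1 * \sum_(k < 2) Y k.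
Proof.
move=> hY; rewrite !big_I2 /=.
have := hY i1 i1; have := hY i1 i2; have := hY i2 i1; have := hY i2 i2; lra.
Qed.

(** The majorant of the time average of [mean_g] supplied by [sum_mean_g]: a vanishing initial term
    plus a Cesàro mean. *)
Definition age_bound n F N : R :=
  N.+1%:R^-1 * F (clip2 z' 1 1) + sample_mean (fun t => mean_state n F t.+1) N.

Lemma age_bound_cvg n F pi : steady_state (trans tie b r n) pi ->
  age_bound n F N @[N --> \oo] --> \sum_phi F phi * pi phi.
Proof.
move=> hpi; rewrite -[X in _ --> X]add0r; apply: cvgD.
  rewrite -[X in _ --> X](mul0r (F (clip2 z' 1 1))); apply: cvgM; last exact: cvg_cst.
  exact: cvg_harmonic.
have := mean_state_cvg n F pi hpi; rewrite -cvg_shiftS => /cesaro.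
exact: cvg_trans.
Qed.

Lemma first_bound (Jc : \bar R) : avg_aoi beta gamma @ \oo --> Jc ->
  (Jc <= (2^-1 * \sum_(k < 2) (btot b k * r i2)^-1)%:E)%E.
Proof.
rewrite -cvg_shiftS; apply: cvge_le; apply: nearW => N /=.
rewrite avg_aoiE lee_fin -[leRHS](sample_mean_cst _ N).
by apply: ler_sample_mean => t; apply: average_user_le => m k; exact: mean_hr_le.
Qed.

Lemma second_bound (Jc : \bar R) pi F : avg_aoi beta gamma @ \oo --> Jc ->
  (forall n, steady_state (trans tie b r n) (pi n)) ->
  (forall n k, 0 < b n k -> reception_system (trans tie b r n) k (F n k)) ->
  (Jc <= (2^-1 * \sum_(k < 2)
       ((1 - btot b k + btot b k * r i2) / (btot b k * r i2)
        + (1 - r i2) * \sum_(n < 2) b n k *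
            \sum_(phi : state z) F n k phi * pi n phi))%:E)%E.
Proof.
rewrite -cvg_shiftS => hJ hpi hF.
(* [U] is the claimed bound as a function of the mean cache ages [A]. It is affine, continuous and,
   on the relevant terms, monotone in them. *)
pose c k := (1 - btot b k + btot b k * r i2) / (btot b k * r i2).
pose V (A : 'I_2 -> 'I_2 -> R) k :=
  c k + (1 - r i2) * (b i1 k * A i1 k + b i2 k * A i2 k).
pose U A := 2^-1 * (V A i1 + V A i2).
rewrite (_ : 2^-1 * _ = U (fun n k => \sum_(phi : state z) F n k phi * pi n phi));
  last by rewrite !big_I2.
have lim : U (fun n k => age_bound n (F n k) N) @[N --> \oo] -->
    U (fun n k => \sum_(phi : state z) F n k phi * pi n phi).
  apply: cvgM; first exact: cvg_cst.
  by apply: cvgD; (apply: cvgD; first exact: cvg_cst);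
    (apply: cvgM; first exact: cvg_cst); apply: cvgD;
    (apply: cvgM; [exact: cvg_cst|exact: age_bound_cvg]).
apply: (@lee_cvg_to _ _ _ _ _ (fun N => (U (fun n k => age_bound n (F n k) N))%:E)
  _ _ hJ); first by apply: cvg_EFin; [exact: nearW|exact: lim].
apply: nearW => N /=; rewrite avg_aoiE lee_fin.
(* The weight [b n k] is kept on both sides: where it vanishes both are 0, and elsewhere the
   reception system is available. *)
have bA n k : b n k * sample_mean (mean_g n k) N <= b n k * age_bound n (F n k) N.
  have /andP[b0 _] := nsr_b hpar n k.
  case: (ltP 0 (b n k)) => [bk|bk]; last by have -> : b n k = 0 by [lra]; rewrite !mul0r.
  by rewrite ler_wpM2l// /age_bound -mulrDr ler_wpM2l// sum_mean_g//; exact: hF.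
apply: (@le_trans _ _ (U (fun n k => sample_mean (mean_g n k) N))).
  (* Being affine, [U] commutes with time averages, which reduces the comparison to single slots. *)
  have -> : U (fun n k => sample_mean (mean_g n k) N) =
      sample_mean (fun t => 2^-1 * (V (fun n k => mean_g n k t) i1 +
        V (fun n k => mean_g n k t) i2)) N.
    rewrite sample_meanZ sample_meanD /V.
    by rewrite !(sample_meanD, sample_meanZ, sample_mean_cst).
  apply: ler_sample_mean => t; rewrite -[V _ i1 + V _ i2]big_I2.
  apply: average_user_le => m k.
  by apply: le_trans (mean_hr_le_g m k t) _; rewrite big_I2.
have /andP[_ r21] := r2_bounds.
have VA k : V (fun n k => sample_mean (mean_g n k) N) k <=
    V (fun n k => age_bound n (F n k) N) k.
  by rewrite /V lerD2l ler_wpM2l ?subr_ge0// lerD.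
by rewrite /U ler_wpM2l// lerD.
Qed.

End ages.

Theorem theorem5 (R : realType) (d : measure_display) (T : measurableType d)
    (P : probability T R) (tie : tie_rule)
    (b : 'I_2 -> 'I_2 -> R) (r : 'I_2 -> R) (Bmax Rmax : R) (z : nat)
    (beta : 'I_2 -> 'I_2 -> 'I_2 -> nat -> {RV P >-> bool})
    (gamma : 'I_2 -> 'I_2 -> nat -> {RV P >-> bool})
    (pi : 'I_2 -> state z -> R) (F : 'I_2 -> 'I_2 -> state z -> R)
    (Jc : \bar R)
    (hpar : nsr_parameters b r Bmax Rmax)
    (hz : (2 <= z)%N)
    (hb : forall k, 0 < btot b k)
    (hr2 : 0 < r i2)
    (hproc : nsr_process beta gamma tie b r z)
    (hJ : avg_aoi beta gamma @ \oo --> Jc)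
    (hpi : forall n, steady_state (trans tie b r n) (pi n))
    (hF : forall n k, 0 < b n k ->
       reception_system (trans tie b r n) k (F n k)) :
  (Jc <= (2^-1 * \sum_(k < 2) (btot b k * r i2)^-1)%:E)%E /\
  (Jc <= (2^-1 * \sum_(k < 2)
       ((1 - btot b k + btot b k * r i2) / (btot b k * r i2)
        + (1 - r i2) * \sum_(n < 2) b n k *
            \sum_(phi : state z) F n k phi * pi n phi))%:E)%E.
Proof.
case: z hz pi F hproc hpi hF => [|[|z']] // _ pi F hproc hpi hF.
split; first exact: (@first_bound R d T P beta gamma tie b r Bmax Rmax z').
exact: (@second_bound R d T P beta gamma tie b r Bmax Rmax z').
Qed.
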